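(* Let $G$ be a finitely generated amenable group, equipped with the word metric of a finite generating set, and let $H\le G$ be a proper subgroup of finite index, i.e. $[G:H]=n>1$. Then the inclusion map $i:H\hookrightarrow G$ is not a bounded distance from a bijective map; that is, there is no bijection $f:H\to G$ with $\sup_{h\in H} d(f(h),i(h))<\infty$.
   Context: For a finitely generated group $G$ with a fixed finite generating set, the word metric is $d(x,y)=\|x^{-1}y\|$, where $\|\cdot\|$ is the word length with respect to the generating set. For $S\subset G$ write $\partial S=\{x\in G : 0<d(x,S)\le 1\}$ and let $|S|$ denote the cardinality of $S$. A finitely generated group $G$ is amenable if there is a sequence of finite (nonempty) subsets $S_i\subset G$ (a Folner sequence) with $\lim_{i\to\infty}|\partial S_i|/|S_i|=0$; this does not depend on the choice of finite generating set. Finite groups are not excluded. Two maps $f,g:X\to Y$ into a metric space $(Y,d)$ are a bounded distance apart if $\sup_{x\in X}d(f(x),g(x))<\infty$; for $Y=G$ this does not depend on the choice of finite generating set. *)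

(* Defs.v *)
From mathcomp Require Import all_boot all_order all_algebra finmap.
From mathcomp Require Import all_classical all_reals all_analysis.
Import numFieldNormedType.Exports.

Set Implicit Arguments.
Unset Strict Implicit.
Unset Printing Implicit Defensive.

Local Open Scope classical_set_scope.
Local Open Scope ring_scope.

(* The value on the empty set is 0 by convention. *)
Definition nat_min (A : set nat) : nat :=
  xget 0%N [set n | A n /\ forall m, A m -> (n <= m)%N].

Section WordMetric.
Variables (G : groupType) (S : {fset G}).

Definition words_for (x : G) : set (seq G) :=
  [set w : seq G | (forall s, s \in w -> s \in S \/ (s^-1)%g \in S) /\
           (\prod_(s <- w) s)%g = x].

Definition generates : Prop := forall x : G, words_for x !=set0.

Definition word_norm (x : G) : nat := nat_min [set size w | w in words_for x].

Definition word_dist (x y : G) : nat := word_norm (x^-1 * y)%g.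

(* Meaningful for nonempty A only, see nat_min. *)
Definition dist_to (x : G) (A : set G) : nat :=
  nat_min [set word_dist x a | a in A].

Definition boundary (A : set G) : set G := [set x | (0 < dist_to x A <= 1)%N].

Definition bounded_distance (X : Type) (f g : X -> G) : Prop :=
  exists M : nat, forall x, (word_dist (f x) (g x) <= M)%N.

(* The boundary of a finite set is finite because S is, so that fset_set does
   not truncate it to the empty set. *)
Definition Folner_sequence (R : realType) (F : nat -> {fset G}) : Prop :=
  (forall i, F i != fset0) /\
  (fun i => #|` fset_set (boundary [set` F i])|%:R / #|` F i|%:R : R)
    @ \oo --> (0 : R).

End WordMetric.

Definition amenable (R : realType) (G : groupType) : Prop :=
  exists S : {fset G}, generates S /\
    exists F : nat -> {fset G}, Folner_sequence S R F.

Definition left_cosets (G : groupType) (H : {pred G}) : set (set G) :=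
  [set [set (x * h)%g | h in [set` H]] | x in [set: G]].

(* Main.v *)
(** Let [g : G -> H] be the inverse of a bijection at bounded distance from the
    inclusion, and pick [x] outside [H]. The maps [y |-> g y] and
    [y |-> g y * x] are injective, have disjoint images (in [H] and [H x]) and
    move points by a bounded amount, so there is a finite [K] with
    [2 |A| <= |A K|] for every finite [A]. For a Folner set [A] the excess of
    [A K] over [A] is at most a constant times the boundary, which gives
    [|A K| < 2 |A|]. *)
Require Import Defs.
From mathcomp Require Import all_boot all_order all_algebra finmap.
From mathcomp Require Import all_classical all_reals all_analysis.

Set Implicit Arguments.
Unset Strict Implicit.
Unset Printing Implicit Defensive.

Import GRing.Theory Num.Theory.

Lemma nat_min_mem (A : set nat) : (A !=set0)%classic -> A (nat_min A).
Proof.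
case=> n An; suff [m [Am mmin]] : exists m, A m /\ forall k, A k -> m <= k.
  by rewrite /nat_min; case: xgetP => [k -> []//|/(_ m)] [].
have exA : exists k, `[< A k >] by exists n; apply/asboolP.
case: (ex_minnP exA) => m /asboolP Am mmin; exists m; split=> // k Ak.
by apply/mmin/asboolP.
Qed.

Lemma nat_min_le (A : set nat) m : A m -> nat_min A <= m.
Proof.
move=> Am; rewrite /nat_min; case: xgetP => [k _ [_ kmin]|_]; first exact: kmin.
(* Here [nat_min A] is the default value 0, which lies below every [m]. *)
exact: leq0n.
Qed.

Section WordMetricTheory.
Local Open Scope fset_scope.
Variables (G : groupType) (S : {fset G}).
Implicit Types (x y : G) (A K : {fset G}).

Lemma word_norm_attained x : generates S ->
  exists2 w, words_for S x w & size w = word_norm S x.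
Proof.
move=> genS; have [w wx] := genS x.
have [|v vx vE] := @nat_min_mem [set size w | w in words_for S x]%classic.
  by exists (size w), w.
by exists v.
Qed.

Lemma word_norm_eq0 x : generates S -> word_norm S x = 0 -> x = 1%g.
Proof.
move=> genS x0; have [w [_ wx]] := word_norm_attained x genS.
by rewrite x0 => /size0nil w0; rewrite -wx w0 big_nil.
Qed.

Lemma word_norm_le1 x : x \in S \/ (x^-1)%g \in S -> word_norm S x <= 1.
Proof.
move=> xS; apply: nat_min_le; exists [:: x] => //; split; last by rewrite big_seq1.
by move=> s /[!inE] /eqP ->.
Qed.

(** Balls are finite because there are finitely many words of bounded length over the finite
    alphabet of generators and their inverses. *)
Lemma word_ball_sub_fset (k : nat) : generates S ->
  exists K : {fset G}, forall x, word_norm S x <= k -> x \in K.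
Proof.
move=> genS; suff [K KP] : exists K : {fset G}, forall w : seq G,
    (forall s, s \in w -> s \in S \/ (s^-1)%g \in S) ->
    size w <= k -> (\prod_(s <- w) s)%g \in K.
  exists K => x; have [w [wS <-] <-] := word_norm_attained x genS.
  exact: KP.
elim: k => [|k [K KP]].
  exists [fset 1%g]%fset => w _; rewrite leqn0 => /nilP ->.
  by rewrite big_nil !inE.
(* The element 1 accounts for the empty word; any other word splits off its first letter. *)
exists (1%g |` [fset (s * y)%g | s in S `|` [fset (s^-1)%g | s in S], y in K])%fset.
move=> [|s w] wS /=; first by rewrite big_nil !inE eqxx.
rewrite ltnS => wk; rewrite big_cons !inE; apply/orP; right.
apply: in_imfset2; last first.
  by apply: KP wk => t tw; apply: wS; rewrite inE tw orbT.
rewrite !inE; apply/orP; have [sS|sS] := wS s (mem_head _ _); [by left|right].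
by apply/imfsetP; exists (s^-1)%g; rewrite ?invgK.
Qed.

Lemma dist_to_attained x A : A != fset0 ->
  exists2 a, a \in A & word_dist S x a = dist_to S x [set` A].
Proof.
case/fset0Pn => a aA.
have [|b bA bE] := @nat_min_mem [set word_dist S x a | a in [set` A]]%classic.
  by exists (word_dist S x a), a.
by exists b.
Qed.

(** A boundary point [x] with nearest point [a] of [A] equals [a / t], where [t = x^-1 * a] lies in
    the unit ball. *)
Lemma finite_boundary A : generates S -> A != fset0 ->
  finite_set (boundary S [set` A]).
Proof.
move=> genS A0; have [K KP] := word_ball_sub_fset 1 genS.
apply: (@sub_finite_set _ _ [set` [fset (a / t)%g | a in A, t in K]%fset]).
  move=> x /andP[_]; have [a aA <-] := dist_to_attained x A0 => /KP xaK.
  apply/imfset2P; exists a => //; exists (x^-1 * a)%g => //.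
  by rewrite invgM invgK mulVKg.
exact: finite_fset.
Qed.

Lemma mem_boundary A a s : generates S -> a \in A ->
  s \in S \/ (s^-1)%g \in S -> (a * s)%g \notin A ->
  (a * s)%g \in fset_set (boundary S [set` A]).
Proof.
move=> genS aA sS asA; have A0 : A != fset0 by apply/fset0Pn; exists a.
rewrite in_fset_set; last exact: finite_boundary.
apply/mem_set/andP; split.
  have [b bA <-] := dist_to_attained (a * s)%g A0.
  rewrite lt0n; apply: contraNneq asA => /(word_norm_eq0 genS) /mulg1_eq.
  by rewrite invgK => ->.
apply: (@leq_trans (word_dist S (a * s)%g a)).
  by apply: nat_min_le; exists a.
rewrite /word_dist invgM mulgVK; apply: word_norm_le1.
by rewrite invgK; case: sS; [right|left].
Qed.

(** Write [y] as a word, whose length serves as [C], and multiply by one letter at a time: each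
    letter adds at most one boundary's worth of points outside [A]. *)
Lemma translate_excess_le y : generates S -> exists C, forall A,
  #|` [fset (a * y)%g | a in A] `\` A| <=
    C * #|` fset_set (boundary S [set` A])|.
Proof.
move=> genS; have [w [wS <-]] := genS y.
exists (size w) => A; elim/last_ind: w wS => [|w s IHw] wS.
  rewrite big_nil leqn0 cardfs_eq0; apply/eqP/fsetP => x; rewrite !inE.
  apply/negbTE; rewrite negb_and negbK; case: imfsetP => [[a aA ->]|_].
    by rewrite mulg1 aA.
  by rewrite orbT.
rewrite size_rcons mulSn -cats1 big_cat big_seq1 /=.
set v := (\prod_(i <- w) i)%g; set B := fset_set _.
set E := ([fset (a * v)%g | a in A] `\` A)%fset.
have vE : #|` E| <= size w * #|` B|.
  by apply: IHw => t tw; apply: wS; rewrite mem_rcons inE tw orbT.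
have sS : s \in S \/ (s^-1)%g \in S by apply: wS; rewrite mem_rcons mem_head.
(* A point [a * v * s] outside [A] has its predecessor [a * v] either in [A], and is then a boundary
   point, or in [E], and is then in the translate of [E] by [s], which has as many elements as
   [E]. *)
apply: (@leq_trans #|` B `|` [fset (e * s)%g | e in E]|).
  apply: fsubset_leq_card; apply/fsubsetP => x /[!inE] /andP[xA].
  case/imfsetP => a /= aA xE; rewrite {}xE mulgA in xA *.
  have [avA|avA] := boolP ((a * v)%g \in A).
    by rewrite mem_boundary.
  apply/orP; right; apply/imfsetP; exists (a * v)%g => //=.
  by rewrite !inE avA /=; apply/imfsetP; exists a.
rewrite cardfsU (leq_trans (leq_subr _ _))// leq_add2l (leq_trans _ vE)//.
by rewrite card_imfset//; apply: mulIg.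
Qed.

(** The excess over [A] is covered by the excesses of the single translates, so their constants add
    up along [s]. *)
Lemma product_card_le (s : seq G) : generates S -> exists C, forall A,
  #|` [fset (a * k)%g | a in A, k in s]| <=
    #|` A| + C * #|` fset_set (boundary S [set` A])|.
Proof.
move=> genS; suff [C CP] : exists C, forall A,
    #|` [fset (a * k)%g | a in A, k in s] `\` A| <=
      C * #|` fset_set (boundary S [set` A])|.
  exists C => A; rewrite -[leqLHS](cardfsID A) leq_add//.
  by apply: fsubset_leq_card; apply: fsubsetIr.
elim: s => [|k s [C CP]].
  exists 0 => A; rewrite leqn0 cardfs_eq0; apply/eqP/fsetP => x; rewrite !inE.
  by apply/negbTE/negP => /andP[_ /imfset2P[a _ [k]]].
have [D DP] := translate_excess_le k genS; exists (D + C)%N => A.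
rewrite mulnDl (leq_trans _ (leq_add (DP A) (CP A)))//.
set E1 := (X in _ <= #|` X| + _); set E2 := (X in _ <= _ + #|` X|).
apply: (@leq_trans #|` E1 `|` E2|); last by rewrite cardfsU leq_subr.
apply: fsubset_leq_card; apply/fsubsetP => x /[!inE] /andP[xA].
case/imfset2P => a /= aA [t /= + xE]; rewrite xA /= inE => /orP[/eqP tk|ts].
  by apply/orP; left; apply/imfsetP; exists a; rewrite //= -tk.
by apply/orP; right; apply/imfset2P; exists a => //; exists t.
Qed.

End WordMetricTheory.

(** The conclusion mentions no generating set, so the one carrying the Folner sequence may differ
    from the one that measures bounded distance. *)
Lemma amenable_product_lt (R : realType) (G : groupType) (s : seq G) :
  amenable R G ->
  exists A : {fset G}, #|` [fset (a * k)%g | a in A, k in s]%fset| < 2 * #|` A|.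
Proof.
case=> S [genS [F [F0 Flim]]]; have [C CP] := product_card_le s genS.
(* With the ratio below [1 / (C + 1)], the excess, at most [C] times the boundary, is smaller than
   [F i]. Using [C.+1] keeps the threshold meaningful when [C = 0]. *)
have e0 : (0 < C.+1%:R^-1 :> R)%R by rewrite invr_gt0 ltr0n.
have [i _ /(_ i (leqnn i))/=] := cvgr0_norm_lt _ Flim _ e0.
have F_gt0 : 0 < #|` F i| by rewrite lt0n cardfs_eq0.
rewrite ger0_norm ?divr_ge0// ltr_pdivrMr ?ltr0n// mulrC ltr_pdivlMr ?ltr0n//.
rewrite -natrM ltr_nat => FC; exists (F i).
apply: leq_ltn_trans (CP (F i)) _; rewrite mul2n -addnn ltn_add2l mulnC.
by apply: leq_ltn_trans FC; rewrite leq_mul2l leqnSn orbT.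
Qed.

(** If [H] were all of [G], the only coset would be [G] itself, forcing [n = 1]. *)
Lemma left_cosets_nontrivial (G : groupType) (H : groupClosed G) n :
  (left_cosets H #= `I_n)%card -> 1 < n -> exists x, x \notin H.
Proof.
move=> cardH n1; apply: contrapT => /forallNP allH.
have HT x : x \in H by apply/negPn/negP/allH.
suff cosetsE : left_cosets H = [set [set: G]]%classic.
  have : (`I_n #= `I_1)%card.
    by rewrite -(card_eql cardH) cosetsE card_set1.
  by move/card_eq_II => nE; rewrite nE in n1.
apply/seteqP; split => [_ [x _ <-]|_ ->] /=.
  apply/seteqP; split => // y _; exists (x^-1 * y)%g; first exact: HT.
  by rewrite mulVKg.
exists 1%g => //; apply/seteqP; split => // y _; exists y; first exact: HT.
by rewrite mul1g.
Qed.

Theorem theorem3p5 (R : realType) (G : groupType) (S : {fset G})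
    (H : groupClosed G) (n : nat) :
  generates S ->
  amenable R G ->
  (left_cosets H #= `I_n)%card ->
  (1 < n)%N ->
  ~ exists f : {x : G | x \in H} -> G,
      bijective f /\ bounded_distance S f (fun h => val h).
Proof.
move=> genS amG cardH n1 [f [[g fK gK] [M fM]]].
have [x xH] := left_cosets_nontrivial cardH n1.
have [K KP] := word_ball_sub_fset M genS.
(* Since [y = f (g y)], the bound on [f] says that [g] moves [y] by at most [M]. *)
have gP y : (y^-1 * val (g y))%g \in K.
  by apply: KP; rewrite -{1}(gK y); apply: fM.
have g_inj : injective (val \o g) by apply: inj_comp val_inj (can_inj gK).
have gx_inj : injective (fun y => val (g y) * x)%g by move=> y z /mulIg /g_inj.
(* The right factors from [K] reach the points [g a], and those from [K x] reach the points
   [g a * x]. *)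
have [A] := amenable_product_lt
  (enum_fset K ++ [seq (k * x)%g | k <- enum_fset K]) amG.
rewrite ltnNge => /negP; apply.
set P := [fset (val \o g) a | a in A]%fset.
set Q := [fset (val (g a) * x)%g | a in A]%fset.
have PQ0 : (P `&` Q = fset0)%fset.
  apply/fsetP => z; rewrite !inE; apply/negP => /andP[/imfsetP[a _ ->]].
  case/imfsetP => b _ /= ab.
  have : (val (g b) * x)%g \in H by rewrite -ab; apply: valP.
  by rewrite (gpredMl _ (valP (g b))) (negbTE xH).
apply: (@leq_trans #|` (P `|` Q)%fset|).
  by rewrite cardfsU PQ0 cardfs0 subn0 !card_imfset// mul2n addnn.
apply: fsubset_leq_card; apply/fsubsetP => z.
rewrite inE => /orP[] /imfsetP[a /= aA ->]; apply/imfset2P; exists a => //.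
  exists (a^-1 * val (g a))%g; last by rewrite mulVKg.
  by rewrite /= mem_cat gP.
exists (a^-1 * val (g a) * x)%g; last by rewrite -!mulgA mulVKg.
by rewrite /= mem_cat (map_f (fun k => k * x)%g (gP a)) orbT.
Qed.
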